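(* The following eight mesh patterns $(12,R)$ are pairwise equidistributed, where $R$ ranges over: $\{(0,2),(1,2),(2,2),(0,1),(2,1),(2,0)\}$, $\{(0,2),(1,2),(2,2),(2,1),(1,0),(2,0)\}$, $\{(0,2),(1,2),(0,1),(0,0),(1,0),(2,0)\}$, $\{(0,2),(0,1),(2,1),(0,0),(1,0),(2,0)\}$, $\{(0,2),(1,2),(2,2),(1,1),(2,1),(2,0)\}$, $\{(0,2),(0,1),(1,1),(0,0),(1,0),(2,0)\}$, $\{(0,2),(1,2),(2,2),(2,1),(0,0),(2,0)\}$, $\{(0,2),(2,2),(0,1),(0,0),(1,0),(2,0)\}$. Moreover, for each such pattern $p$, with $F(x)=\sum_{n\ge0}n!x^n$, $A(x)=\sum_{n\ge0}s_{n,0}(p)x^n$ and $F(x,q)=\sum_{n\ge0}x^n\sum_{\pi\in S_n}q^{p(\pi)}$, $$A(x)=(1-x)F(x)+x,\qquad F(x,q)=(1-x)F(x)+x+x\sum_{n\ge1}\prod_{i=0}^{n-1}(q+i)\,x^n.$$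
   Context: For $R\subseteq\{0,1,2\}^2$ and $\pi=\pi_1\cdots\pi_n\in S_n$, an occurrence of the mesh pattern $(12,R)$ in $\pi$ is a pair of positions $i_1<i_2$ with $\pi_{i_1}<\pi_{i_2}$ such that, setting $x_0=0,x_1=i_1,x_2=i_2,x_3=n+1$ and $y_0=0,y_1=\pi_{i_1},y_2=\pi_{i_2},y_3=n+1$, for every $(a,b)\in R$ there is no index $k$ with $x_a<k<x_{a+1}$ and $y_b<\pi_k<y_{b+1}$. $p(\pi)$ is the number of occurrences of $p$ in $\pi$; $s_{n,k}(p)$ the number of $\pi\in S_n$ with $p(\pi)=k$; $p_1,p_2$ are equidistributed if $s_{n,k}(p_1)=s_{n,k}(p_2)$ for all $n,k\ge 0$. Generating functions are formal power series. *)

(* Defs.v *)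
From HB Require Import structures.
From mathcomp Require Import all_boot all_order all_algebra all_fingroup.
From mathcomp Require Import boolp.

Set Implicit Arguments.
Unset Strict Implicit.
Unset Printing Implicit Defensive.

Import GRing.Theory.
Local Open Scope ring_scope.

(* Formal power series over a commutative ring: FPS a is \sum_n a_n x^n. *)
Record fps (R : Type) := FPS { fps_coef : nat -> R }.

Section FormalPowerSeries.
Variable R : comNzRingType.
Implicit Types f g h : fps R.

Lemma fps_coefK : cancel (@fps_coef R) (@FPS R).
Proof. by case. Qed.

HB.instance Definition _ := Choice.copy (fps R) (can_type fps_coefK).

Lemma fpsP f g : (forall n, fps_coef f n = fps_coef g n) -> f = g.
Proof. by case: f g => f [g] /= /funext ->. Qed.

Definition fps_zero : fps R := FPS (fun=> 0).
Definition fps_opp f : fps R := FPS (fun n => - fps_coef f n).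
Definition fps_add f g : fps R := FPS (fun n => fps_coef f n + fps_coef g n).
Definition fps_one : fps R := FPS (fun n => (n == 0)%:R).
Definition fps_mul f g : fps R :=
  FPS (fun n => \sum_(i < n.+1) fps_coef f i * fps_coef g (n - i)).

Fact fps_addA : associative fps_add.
Proof. by move=> f g h; apply: fpsP => n /=; rewrite addrA. Qed.
Fact fps_addC : commutative fps_add.
Proof. by move=> f g; apply: fpsP => n /=; rewrite addrC. Qed.
Fact fps_add0 : left_id fps_zero fps_add.
Proof. by move=> f; apply: fpsP => n /=; rewrite add0r. Qed.
Fact fps_addN : left_inverse fps_zero fps_opp fps_add.
Proof. by move=> f; apply: fpsP => n /=; rewrite addNr. Qed.

HB.instance Definition _ :=
  GRing.isZmodule.Build (fps R) fps_addA fps_addC fps_add0 fps_addN.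

(* Coefficients up to n of a product only depend on the truncations of the
   factors, so the ring laws are inherited from polynomials. *)
Definition fps_trunc n f : {poly R} := \poly_(i < n.+1) fps_coef f i.

Lemma coef_fps_trunc n f i : (i <= n)%N -> (fps_trunc n f)`_i = fps_coef f i.
Proof. by move=> le_in; rewrite coef_poly ltnS le_in. Qed.

Lemma coef_fps_mul n f g i : (i <= n)%N ->
  fps_coef (fps_mul f g) i = (fps_trunc n f * fps_trunc n g)`_i.
Proof.
move=> le_in; rewrite coefM; apply: eq_bigr => j _.
have le_ji : (j <= i)%N by rewrite -ltnS.
rewrite !coef_fps_trunc ?(leq_trans le_ji) //.
by rewrite (leq_trans (leq_subr _ _)).
Qed.

Fact fps_mulA : associative fps_mul.
Proof.
move=> f g h; apply: fpsP => n.
transitivity ((fps_trunc n f * (fps_trunc n g * fps_trunc n h))`_n).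
  rewrite coefM; apply: eq_bigr => i _.
  rewrite coef_fps_trunc -1?ltnS //.
  by rewrite (@coef_fps_mul n) ?leq_subr.
rewrite mulrA [LHS]coefM; apply: eq_bigr => i _.
have le_in : (i <= n)%N by rewrite -ltnS.
by rewrite (coef_fps_mul f g le_in) coef_fps_trunc ?leq_subr.
Qed.

Fact fps_mulC : commutative fps_mul.
Proof.
by move=> f g; apply: fpsP => n; rewrite !(coef_fps_mul _ _ (leqnn n)) mulrC.
Qed.

Fact fps_mul1 : left_id fps_one fps_mul.
Proof.
move=> f; apply: fpsP => n /=; rewrite big_ord_recl /= mul1r subn0 big1 ?addr0 //.
by move=> i _; rewrite mul0r.
Qed.

Fact fps_mulDl : left_distributive fps_mul fps_add.
Proof.
move=> f g h; apply: fpsP => n /=; rewrite -big_split /=.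
by apply: eq_bigr => i _; rewrite mulrDl.
Qed.

Fact fps_one_neq0 : fps_one != 0 :> fps R.
Proof.
by apply/eqP => /(congr1 (fun f => fps_coef f 0)) /eqP; rewrite /= oner_eq0.
Qed.

HB.instance Definition _ := GRing.Zmodule_isComNzRing.Build (fps R)
  fps_mulA fps_mulC fps_mul1 fps_mulDl fps_one_neq0.

Definition fpsX : fps R := FPS (fun n => (n == 1)%:R).

Definition fact_fps : fps R := FPS (fun n => (n`!)%:R).

End FormalPowerSeries.

Arguments fpsX {R}.
Arguments fact_fps {R}.

(* The shading R of a mesh pattern (12, R); the box (a, b) has column a and
   row b. *)
Definition shading := {set 'I_3 * 'I_3}.

Definition boxes (s : seq (nat * nat)) : shading :=
  [set ab : 'I_3 * 'I_3 | (ab.1 : nat, ab.2 : nat) \in s].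

Section Occurrences.
Variables (n : nat) (R : shading) (pi : 'S_n).

(* 'I_n is {0, ..., n-1}, so position i and its value pi i stand for the
   1-based i.+1 and (pi i).+1. *)
Definition mesh_x (ij : 'I_n * 'I_n) (a : nat) : nat :=
  nth n.+1 [:: 0; ij.1.+1; ij.2.+1; n.+1]%N a.

Definition mesh_y (ij : 'I_n * 'I_n) (b : nat) : nat :=
  nth n.+1 [:: 0; (pi ij.1).+1; (pi ij.2).+1; n.+1]%N b.

Definition box_empty (ij : 'I_n * 'I_n) (ab : 'I_3 * 'I_3) : bool :=
  [forall k : 'I_n,
     ~~ ((mesh_x ij ab.1 < k.+1 < mesh_x ij ab.1.+1) &&
         (mesh_y ij ab.2 < (pi k).+1 < mesh_y ij ab.2.+1))]%N.

Definition occurrence (ij : 'I_n * 'I_n) : bool :=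
  [&& (ij.1 < ij.2)%N, (pi ij.1 < pi ij.2)%N
    & [forall ab in R, box_empty ij ab]].

Definition occ : nat := #|[set ij | occurrence ij]|.

End Occurrences.

Definition occ_count (n k : nat) (R : shading) : nat :=
  #|[set pi : 'S_n | occ R pi == k]|.

Definition equidistributed (R1 R2 : shading) : Prop :=
  forall n k, occ_count n k R1 = occ_count n k R2.

Definition avoid_fps (R : shading) : fps int :=
  FPS (fun n => (occ_count n 0 R)%:R).

(* The joint generating function F(x, q) lives in Z[q][[x]]: the polynomial
   variable 'X is q, and fpsX is x. *)
Definition distr_fps (R : shading) : fps {poly int} :=
  FPS (fun n => \sum_(pi : 'S_n) 'X ^+ occ R pi).

(* \sum_(n >= 1) (\prod_(0 <= i < n) (q + i)) x^n *)
Definition rising_fps : fps {poly int} :=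
  FPS (fun n => if (0 < n)%N then \prod_(0 <= i < n) ('X + i%:R) else 0).

Definition shadings8 : seq shading :=
  [seq boxes s | s <-
    [:: [:: (0,2); (1,2); (2,2); (0,1); (2,1); (2,0)];
        [:: (0,2); (1,2); (2,2); (2,1); (1,0); (2,0)];
        [:: (0,2); (1,2); (0,1); (0,0); (1,0); (2,0)];
        [:: (0,2); (0,1); (2,1); (0,0); (1,0); (2,0)];
        [:: (0,2); (1,2); (2,2); (1,1); (2,1); (2,0)];
        [:: (0,2); (0,1); (1,1); (0,0); (1,0); (2,0)];
        [:: (0,2); (1,2); (2,2); (2,1); (0,0); (2,0)];
        [:: (0,2); (2,2); (0,1); (0,0); (1,0); (2,0)]]%N].

(* Main.v *)
(* Each shading contains either the top row and the right column plus one box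
   (a, b) with a, b <= 1, or the image of such a set under a half-turn. In the
   first case the larger point of an occurrence must be the last position and
   carry the largest value, and the extra box makes the smaller point a record
   of one of the four kinds (left-to-right or right-to-left, maximum or minimum)
   of the remaining permutation. Deleting the last entry of a permutation of
   n.+1 points thus leaves n * n! permutations without occurrences and n! in
   which the occurrences are counted by records; inserting at an end an entry
   seen by no other one gives the generating polynomial \prod_(i < n) (q + i)
   of records. *)
Require Import Defs.
From mathcomp Require Import all_boot all_order all_algebra all_fingroup.
From mathcomp Require Import zify.

Set Implicit Arguments.
Unset Strict Implicit.
Unset Printing Implicit Defensive.

Import GRing.Theory.
Local Open Scope ring_scope.

(** * Permutations with one prescribed value *)

Lemma lift_permK (n : nat) (p k : 'I_n.+1) :
  {on [pred s : 'S_n.+1 | s p == k], bijective (@lift_perm n p k)}.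
Proof.
have inj : injective (@lift_perm n p k).
  move=> s t /permP st; apply/permP=> i.
  by have := st (lift p i); rewrite !lift_perm_lift => /lift_inj.
have im (s : 'S_n.+1) : s p = k -> exists t, lift_perm p k t == s.
  move=> sp.
  (* Since [s] takes the value [k] only at [p], its values elsewhere are all lifts along [k]. *)
  have sl i : exists j, s (lift p i) == lift k j.
    case: (unliftP k (s (lift p i))) => [j ->|E]; first by exists j.
    move: E; rewrite -sp => /perm_inj E.
    by have := neq_lift p i; rewrite E eqxx.
  have f_inj : injective (fun i => xchoose (sl i)).
    move=> i j /(congr1 (lift k)).
    rewrite -(eqP (xchooseP (sl i))) -(eqP (xchooseP (sl j))).
    by move/perm_inj/lift_inj.
  exists (perm f_inj); apply/eqP/permP=> i.
  case: (unliftP p i) => [j ->|->]; last by rewrite lift_perm_id.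
  by rewrite lift_perm_lift permE -(eqP (xchooseP (sl j))).
(* The default [1%g] is returned only when [s p != k], outside the domain considered. *)
exists (fun s => odflt 1%g [pick t | lift_perm p k t == s]).
- move=> s _; case: pickP => [t /eqP /inj //|/(_ s)].
  by rewrite eqxx.
- move=> s; rewrite inE => /eqP /im [t /eqP <-].
  by case: pickP => [u /eqP //|/(_ t)]; rewrite eqxx.
Qed.

(** Each fibre of the value at [p] is a copy of ['S_n]. This is the recursion on size for both
    records and occurrences. *)
Lemma sum_lift_perm (V : nmodType) (n : nat) (p : 'I_n.+1) (F : 'S_n.+1 -> V) :
  \sum_s F s = \sum_k \sum_s F (lift_perm p k s).
Proof.
rewrite (partition_big (fun s : 'S_n.+1 => s p) predT) //=.
apply: eq_bigr => k _; rewrite (reindex _ (lift_permK p k)) /=.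
by apply: eq_bigl => s; rewrite lift_perm_id eqxx.
Qed.

Lemma forall_lift (n : nat) (p : 'I_n.+1) (P : pred 'I_n.+1) :
  [forall i, P i] = P p && [forall i, P (lift p i)].
Proof.
apply/forallP/andP => [h|[Pp /forallP h] i]; first by split=> //; apply/forallP.
by case: (unliftP p i) => [j ->|->].
Qed.

Lemma ltn_lift (n : nat) (p : 'I_n.+1) (i j : 'I_n) :
  (lift p i < lift p j)%N = (i < j)%N.
Proof. by rewrite !ltnNge leq_bump2. Qed.

(** * The four kinds of records, treated uniformly *)

Definition beyond (a : bool) (x y : nat) : bool :=
  if a then (x < y)%N else (y < x)%N.

Definition record (a b : bool) (n : nat) (s : 'S_n) (i : 'I_n) : bool :=
  [forall k : 'I_n, ~~ (beyond a i k && beyond b (s i) (s k))].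

(* [records false true] counts left-to-right maxima and [records true false]
   right-to-left minima; the other two choices give left-to-right minima and
   right-to-left maxima. *)
Definition records (a b : bool) (n : nat) (s : 'S_n) : nat :=
  \sum_(i < n) record a b s i.

Lemma record_lift_perm (a b : bool) (n : nat) (p k : 'I_n.+1) (s : 'S_n)
    (i : 'I_n) :
  record a b (lift_perm p k s) (lift p i) =
  ~~ (beyond a (lift p i) p && beyond b (lift k (s i)) k) && record a b s i.
Proof.
rewrite /record (forall_lift p) lift_perm_id lift_perm_lift; congr andb.
apply: eq_forallb => j; rewrite lift_perm_lift /beyond.
by case: a; case: b; rewrite !ltn_lift.
Qed.

Definition endpoint (c : bool) (n : nat) : 'I_n.+1 :=
  if c then ord_max else ord0.

Lemma beyond_endpoint (c : bool) (n : nat) (i : 'I_n.+1) :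
  beyond c (endpoint c n) i = false.
Proof. by case: c => /=; rewrite /beyond /= ?ltn0 // ltnNge -ltnS ltn_ord. Qed.

Lemma beyond_other_endpoint (c : bool) (n : nat) (i : 'I_n.+1) :
  beyond c i (endpoint (~~ c) n) = false.
Proof. by case: c => /=; rewrite /beyond /= ?ltn0 // ltnNge -ltnS ltn_ord. Qed.

(* Read the permutation so that the last entry sees all the others and none of
   them sees it: it is a record exactly when its value is extremal. *)
Lemma records_lift_perm (a b : bool) (n : nat) (k : 'I_n.+1) (s : 'S_n) :
  records a b (lift_perm (endpoint (~~ a) n) k s) =
  ((k == endpoint b n) + records a b s)%N.
Proof.
set p := endpoint _ _.
rewrite /records (bigD1_ord p) //=; congr addn; last first.
  by apply: eq_bigr => i _; rewrite record_lift_perm beyond_other_endpoint.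
congr nat_of_bool; rewrite /record lift_perm_id.
apply/forallP/eqP => [h|-> i]; last by rewrite beyond_endpoint andbF.
(* If [k] is not extremal, the extremal value sits at another position, and that entry lies beyond
   the inserted one in both directions. *)
apply/eqP; apply: contraT => neq.
case: (unliftP k (endpoint b n)) neq => [j E _|->]; last by rewrite eqxx.
have := h (lift p ((s^-1)%g j)); rewrite lift_perm_lift permKV -E.
have : beyond a p (lift p ((s^-1)%g j)).
  have := neq_lift p ((s^-1)%g j); move: (lift p _) => q.
  rewrite /p -val_eqE /beyond /endpoint; case: (a) => /=.
    by rewrite lt0n eq_sym.
  by rewrite eq_sym ltn_neqAle -ltnS ltn_ord andbT.
move=> -> /=; have := neq_lift k j; rewrite -E -val_eqE /beyond /endpoint.
case: (b) => /=; last by rewrite lt0n => ->.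
by rewrite ltn_neqAle -[X in _ && X]ltnS ltn_ord andbT => ->.
Qed.

(** Of the [n.+1] values for the inserted entry, the extremal one adds a record and the other [n]
    add none, whence the factor ['X + n%:R]. *)
Lemma sum_records (R : nzRingType) (a b : bool) (n : nat) :
  \sum_(s : 'S_n) ('X : {poly R}) ^+ records a b s =
  \prod_(0 <= i < n) ('X + i%:R).
Proof.
elim: n => [|n IHn].
  rewrite big_nil (eq_bigr (fun=> 1)); last by move=> s _; rewrite /records big_ord0.
  by rewrite sumr_const card_Sn.
rewrite big_nat_recr //= -IHn (sum_lift_perm (endpoint (~~ a) n)).
rewrite (bigD1 (endpoint b n)) //= mulrDr; congr (_ + _).
  rewrite big_distrl; apply: eq_bigr => s _.
  by rewrite records_lift_perm eqxx /= exprSr.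
rewrite (eq_bigr (fun=> \sum_(s : 'S_n) 'X ^+ records a b s)); last first.
  by move=> k /negPf neq; apply: eq_bigr => s _; rewrite records_lift_perm neq.
by rewrite sumr_const cardC1 card_ord mulr_natr.
Qed.

(** * Occurrences for corner shadings *)

Lemma occurrence_boxes (n : nat) (s : seq (nat * nat)) (pi : 'S_n) (ij : 'I_n * 'I_n) :
  all (fun ab => (ab.1 < 3) && (ab.2 < 3))%N s ->
  occurrence (boxes s) pi ij =
  [&& (ij.1 < ij.2)%N, (pi ij.1 < pi ij.2)%N
    & all (fun ab => [forall k : 'I_n,
     ~~ ((mesh_x ij ab.1 < k.+1 < mesh_x ij ab.1.+1) &&
         (mesh_y pi ij ab.2 < (pi k).+1 < mesh_y pi ij ab.2.+1))])%N s].
Proof.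
move=> /allP lt3; congr [&& _, _ & _]; apply/forall_inP/allP => h.
- case=> x y xy; have /andP[/= ltx lty] := lt3 _ xy.
  by apply: (h (Ordinal ltx, Ordinal lty)); rewrite inE.
- by case=> x y; rewrite inE => /h.
Qed.

Definition corner (a b : bool) : shading :=
  boxes [:: (0,2); (1,2); (2,2); (2,1); (2,0); (a : nat, b : nat)]%N.

Lemma occurrence_corner (a b : bool) (n : nat) (pi : 'S_n.+1)
    (i j : 'I_n.+1) :
  occurrence (corner a b) pi (i, j) =
  [&& j == ord_max, pi j == ord_max, i != ord_max
    & [forall k, (k != ord_max) ==>
        ~~ (beyond a i k && beyond b (pi i) (pi k))]].
Proof.
rewrite occurrence_boxes; last by case: a; case: b.
rewrite /= !andbT.
apply/and3P/and4P.
- case=> lij lpij /and5P[/forallP h02 /forallP h12 /forallP h22 /forallP h21].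
  move=> /andP[/forallP h20 /forallP hab].
  have neq (k l : 'I_n.+1) : (k : nat) <> l -> (pi k : nat) <> pi l.
    by move=> kl /val_inj /perm_inj E; apply: kl; rewrite E.
  (* Otherwise the point at the last position would lie in a box of the right column. *)
  have jmax : j = ord_max.
    apply/val_inj => /=; apply/eqP; apply: contraT => nj.
    have ltj : (j < @ord_max n)%N by move: nj (ltn_ord j) => /=; lia.
    have n1 := neq ord_max j; have n2 := neq ord_max i.
    move: (h22 ord_max) (h21 ord_max) (h20 ord_max).
    rewrite /mesh_x /mesh_y /=; move: ltj (ltn_ord (pi ord_max)) n1 n2 lij => /=; lia.
  (* Otherwise the point with the largest value would lie in a box of the top row. *)
  have pijmax : pi j = ord_max.
    apply/val_inj => /=; apply/eqP; apply: contraT => npj.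
    pose k := (pi^-1)%g ord_max.
    have pk : (pi k : nat) = n by rewrite permKV.
    have n1 := neq k j; have n2 := neq k i.
    have kj : (k : nat) <> j.
      by move=> /val_inj E; move: npj; rewrite -E pk eqxx.
    have ki : (k : nat) <> i.
      move=> /val_inj E; move: lpij; rewrite -E pk.
      by move: (ltn_ord (pi j)); lia.
    move: (h02 k) (h12 k) (h22 k).
    rewrite /mesh_x /mesh_y /= pk; move: npj (ltn_ord (pi j)) (ltn_ord k) lpij lij.
    move=> /=; lia.
  split; [exact/eqP|exact/eqP| |].
    by rewrite -val_eqE -jmax /=; move: lij => /=; lia.
  apply/forall_inP=> k kmax; have := hab k.
  have kj : (k : nat) <> j.
    by move=> /val_inj E; move: kmax; rewrite E jmax eqxx.
  have pkj := neq _ _ kj.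
  rewrite /mesh_x /mesh_y /beyond; move: lij lpij kj pkj; rewrite jmax in pijmax *.
  rewrite pijmax; move: (ltn_ord k) (ltn_ord (pi k)) => /=.
  by case: (a); case: (b) => /=; lia.
- case=> /eqP jmax /eqP pij imax /forall_inP h.
  have li : (i < n)%N by move: imax (ltn_ord i); rewrite -val_eqE /=; lia.
  have lpi : (pi i < n)%N.
    have : pi i != ord_max by rewrite -pij jmax (inj_eq perm_inj).
    by move: (ltn_ord (pi i)); rewrite -val_eqE /=; lia.
  have jn : (j : nat) = n by rewrite jmax.
  have pjn : (pi j : nat) = n by rewrite pij.
  rewrite /= jn pjn; split => //; rewrite /mesh_x /mesh_y /= jn pjn.
  (* The top row and the right column are void: no value or position exceeds that of the larger
     point. *)
  do 5![apply/andP; split; first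
    by apply/forallP => k; move: (ltn_ord k) (ltn_ord (pi k)); lia].
  apply/forallP => k; have [-> |kmax] := eqVneq k ord_max.
    by rewrite -jmax; case: (a); case: (b) => /=; lia.
  by have := h k kmax; rewrite /beyond; case: (a); case: (b) => /=; lia.
Qed.

Lemma occE (n : nat) (R : shading) (pi : 'S_n) :
  occ R pi = (\sum_i \sum_j occurrence R pi (i, j))%N.
Proof.
rewrite /occ -sum1_card big_mkcond /= pair_big /=.
by apply: eq_bigr => -[i j] _; rewrite inE; case: occurrence.
Qed.

Lemma occ_corner (a b : bool) (n : nat) (k : 'I_n.+1) (s : 'S_n) :
  occ (corner a b) (lift_perm ord_max k s) =
  if k == ord_max then records a b s else 0%N.
Proof.
have occ_i i : (\sum_j occurrence (corner a b) (lift_perm ord_max k s) (i, j))%N =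
   occurrence (corner a b) (lift_perm ord_max k s) (i, ord_max).
  rewrite (bigD1 ord_max) //= big1 ?addn0 // => j /negPf neq.
  by rewrite occurrence_corner neq.
rewrite occE (eq_bigr _ (fun i _ => occ_i i)).
rewrite (bigD1_ord ord_max) //= occurrence_corner !eqxx /= andbF add0n.
case: ifP => [/eqP ->|neq]; last first.
  by apply: big1 => i _; rewrite occurrence_corner lift_perm_id neq andbF.
apply: eq_bigr => i _; rewrite occurrence_corner lift_perm_id !eqxx.
rewrite eq_sym neq_lift (forall_lift ord_max) eqxx !andTb.
congr nat_of_bool; apply: eq_forallb => j.
rewrite eq_sym neq_lift implyTb !lift_perm_lift /beyond.
by case: (a); case: (b); rewrite !ltn_lift.
Qed.

Lemma sum_occ_corner (a b : bool) (n : nat) :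
  \sum_(pi : 'S_n.+1) ('X : {poly int}) ^+ occ (corner a b) pi =
  (n * n`!)%:R + \prod_(0 <= i < n) ('X + i%:R).
Proof.
rewrite (sum_lift_perm ord_max) (bigD1 ord_max) //= addrC.
rewrite -(sum_records _ a b); congr (_ + _); last first.
  by apply: eq_bigr => s _; rewrite occ_corner eqxx.
rewrite (eq_bigr (fun=> (n`!)%:R)) => [|k /negPf neq].
  by rewrite sumr_const cardC1 card_ord -mulrnA mulnC.
rewrite (eq_bigr (fun=> 1)) => [|s _]; last by rewrite occ_corner neq.
by rewrite sumr_const card_Sn.
Qed.

(** * Half-turn symmetry *)

Definition rotate (R : shading) : shading :=
  [set ab | (rev_ord ab.1, rev_ord ab.2) \in R].

Definition rev_perm (n : nat) : 'S_n := perm (@rev_ord_inj n).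

Definition rotate_perm (n : nat) (pi : 'S_n) : 'S_n :=
  (rev_perm n * pi * rev_perm n)%g.

(** Reversal exchanges left and right, so the components are swapped to keep the smaller position
    first. *)
Definition rotate_pair (n : nat) (ij : 'I_n * 'I_n) : 'I_n * 'I_n :=
  (rev_ord ij.2, rev_ord ij.1).

Lemma rotate_permE (n : nat) (pi : 'S_n) (i : 'I_n) :
  rotate_perm pi i = rev_ord (pi (rev_ord i)).
Proof. by rewrite !permM !permE. Qed.

Lemma rotate_permK (n : nat) : involutive (@rotate_perm n).
Proof. by move=> pi; apply/permP=> i; rewrite !rotate_permE !rev_ordK. Qed.

Lemma rotate_pairK (n : nat) : involutive (@rotate_pair n).
Proof. by case=> i j; rewrite /rotate_pair !rev_ordK. Qed.

Lemma box_empty_rotate (n : nat) (pi : 'S_n) (ij : 'I_n * 'I_n)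
    (ab : 'I_3 * 'I_3) :
  box_empty (rotate_perm pi) (rotate_pair ij) ab =
  box_empty pi ij (rev_ord ab.1, rev_ord ab.2).
Proof.
rewrite /box_empty.
(* One-dimensional form of the claim, applied to positions and to values alike. *)
have side (x y z : 'I_n) (c : 'I_3) :
    let m u v d := nth n.+1 [:: 0; u.+1; v.+1; n.+1]%N d in
    (m (rev_ord y) (rev_ord x) c < (rev_ord z).+1 < m (rev_ord y) (rev_ord x) c.+1)%N
    = (m x y (rev_ord c) < z.+1 < m x y (rev_ord c).+1)%N.
  move: (ltn_ord x) (ltn_ord y) (ltn_ord z).
  by case: c => -[|[|[|//]]] ? /=; lia.
case: ij ab => i j [a b]; rewrite /mesh_x /mesh_y /= !rotate_permE !rev_ordK.
apply/forallP/forallP => h k; have := h (rev_ord k).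
- by rewrite !rotate_permE rev_ordK !side.
- by rewrite -!side rotate_permE !rev_ordK.
Qed.

Lemma occurrence_rotate (n : nat) (R : shading) (pi : 'S_n)
    (ij : 'I_n * 'I_n) :
  occurrence (rotate R) (rotate_perm pi) (rotate_pair ij) =
  occurrence R pi ij.
Proof.
case: ij => i j; rewrite /occurrence /= !rotate_permE !rev_ordK /=.
congr [&& _, _ & _].
- by move: (ltn_ord i) (ltn_ord j); lia.
- by move: (ltn_ord (pi i)) (ltn_ord (pi j)); lia.
apply/forall_inP/forall_inP => h [a b] abR.
- have := h (rev_ord a, rev_ord b); rewrite inE /= !rev_ordK => /(_ abR).
  by rewrite (box_empty_rotate pi (i, j)) /= !rev_ordK.
- by rewrite (box_empty_rotate pi (i, j)); apply: h; move: abR; rewrite inE.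
Qed.

Lemma occ_rotate (n : nat) (R : shading) (pi : 'S_n) :
  occ (rotate R) (rotate_perm pi) = occ R pi.
Proof.
rewrite /occ -[RHS](card_imset _ (inv_inj (@rotate_pairK n))).
apply: eq_card => ij; rewrite inE; apply/idP/imsetP.
- move=> h; exists (rotate_pair ij); rewrite ?rotate_pairK // inE.
  by rewrite -occurrence_rotate rotate_pairK.
- by case=> kl; rewrite inE => h ->; rewrite occurrence_rotate.
Qed.

(** * Reduction of the eight shadings to corners *)

Lemma shadings8P (R : shading) : R \in shadings8 ->
  exists a b, R = corner a b \/ R = rotate (corner a b).
Proof.
rewrite !inE.
have corner_eq s (a b : bool) :
    perm_eq s [:: (0,2); (1,2); (2,2); (2,1); (2,0); (a : nat, b : nat)]%N ->
    boxes s = corner a b.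
  by move=> /perm_mem E; apply/setP => ab; rewrite !inE E !inE.
have rotate_eq s (a b : bool) :
    perm_eq s [:: (2,0); (1,0); (0,0); (0,1); (0,2);
                  (2 - a, 2 - b)]%N ->
    boxes s = rotate (corner a b).
  move=> /perm_mem E; apply/setP => -[x y]; rewrite !inE E !inE.
  by case: a E => _; case: b; case: x => -[|[|[|//]]] ?; case: y => -[|[|[|//]]] ?.
(* The witnesses are the coordinates of the box outside the top row and right column, after a
   half-turn in the [right] cases. *)
case/orP=> [/eqP->|]; first by exists false, true; left; apply: corner_eq.
case/orP=> [/eqP->|]; first by exists true, false; left; apply: corner_eq.
case/orP=> [/eqP->|]; first by exists true, false; right; apply: rotate_eq.
case/orP=> [/eqP->|]; first by exists false, true; right; apply: rotate_eq.
case/orP=> [/eqP->|]; first by exists true, true; left; apply: corner_eq.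
case/orP=> [/eqP->|]; first by exists true, true; right; apply: rotate_eq.
case/orP=> [/eqP->|/eqP->]; first by exists false, false; left; apply: corner_eq.
by exists false, false; right; apply: rotate_eq.
Qed.

Lemma sum_occ (R : shading) (n : nat) : R \in shadings8 ->
  \sum_(pi : 'S_n.+1) ('X : {poly int}) ^+ occ R pi =
  (n * n`!)%:R + \prod_(0 <= i < n) ('X + i%:R).
Proof.
case/shadings8P=> a [b [->|->]]; first exact: sum_occ_corner.
rewrite -(sum_occ_corner a b) (reindex_inj (inv_inj (@rotate_permK n.+1))).
by apply: eq_bigr => pi _; rewrite occ_rotate.
Qed.

Lemma occ0 (R : shading) (pi : 'S_0) : occ R pi = 0%N.
Proof. by rewrite occE big_ord0. Qed.

(** * Comparison of power series coefficients *)

Lemma coef_X_mul (R : comNzRingType) (f : fps R) (n : nat) :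
  fps_coef (fpsX * f) n = if n is m.+1 then fps_coef f m else 0.
Proof.
rewrite /GRing.mul /=; case: n => [|n].
  by rewrite big_ord1 mul0r.
rewrite (bigD1 (lift ord0 ord0)) //= subn1 mul1r big1 ?addr0 // => i.
by rewrite -val_eqE /= => /negPf ->; rewrite mul0r.
Qed.

Lemma coef_one_sub_X_fact (R : comNzRingType) (n : nat) :
  fps_coef ((1 - fpsX) * fact_fps + fpsX : fps R) n =
  if n is m.+1 then (m * m`!)%:R + (m == 0)%:R else 1.
Proof.
rewrite mulrBl mul1r.
have -> : fps_coef (fact_fps - fpsX * fact_fps + fpsX : fps R) n =
  (n`!)%:R - fps_coef (fpsX * fact_fps : fps R) n + (n == 1)%:R by [].
rewrite coef_X_mul; case: n => [|n]; first by rewrite subr0 addr0.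
by rewrite eqSS factS mulSn natrD; congr (_ + _); rewrite addrAC subrr add0r.
Qed.

Lemma distr_fpsE (R : shading) : R \in shadings8 ->
  distr_fps R = (1 - fpsX) * fact_fps + fpsX + fpsX * rising_fps.
Proof.
move=> R8; apply: fpsP => n.
have -> : fps_coef ((1 - fpsX) * fact_fps + fpsX + fpsX * rising_fps) n =
  fps_coef ((1 - fpsX) * fact_fps + fpsX : fps {poly int}) n
  + fps_coef (fpsX * rising_fps) n by [].
rewrite coef_one_sub_X_fact coef_X_mul /=; case: n => [|n].
  rewrite (eq_bigr (fun=> 1)) => [|pi _]; last by rewrite occ0.
  by rewrite sumr_const card_Sn addr0.
rewrite sum_occ // -addrA; congr (_ + _).
(* For permutations of one point the product is empty and equals 1; [rising_fps] has no constant
   term, so [fpsX] supplies this 1. *)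
by case: n => [|n]; rewrite ?big_nil ?addr0 ?add0r.
Qed.

(** Extracting the coefficient of ['X^k] turns equality of the joint series into
    equidistribution. *)
Lemma occ_countE (n k : nat) (R : shading) :
  (occ_count n k R)%:R = (fps_coef (distr_fps R) n)`_k.
Proof.
rewrite /occ_count -sum1dep_card natr_sum /= coef_sum big_mkcond /=.
by apply: eq_bigr => pi _; rewrite coefXn eq_sym; case: eqP.
Qed.

Theorem theorem3p15 :
  (forall R1 R2 : shading, R1 \in shadings8 -> R2 \in shadings8 ->
     equidistributed R1 R2) /\
  (forall R : shading, R \in shadings8 ->
     avoid_fps R = (1 - fpsX) * fact_fps + fpsX /\
     distr_fps R = (1 - fpsX) * fact_fps + fpsX + fpsX * rising_fps).
Proof.
split=> [R1 R2 h1 h2 n k|R h].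
  apply/eqP; rewrite -(Num.Theory.eqr_nat int); apply/eqP.
  by rewrite !occ_countE !distr_fpsE.
split; last exact: distr_fpsE.
apply: fpsP => n; rewrite coef_one_sub_X_fact.
have -> : fps_coef (avoid_fps R) n = (occ_count n 0 R)%:R by [].
rewrite occ_countE; case: n => [|n].
  rewrite /= coef_sum (eq_bigr (fun=> 1)) => [|pi _]; last by rewrite occ0 coef1.
  by rewrite sumr_const card_Sn.
rewrite /= sum_occ // coefD -polyC_natr coefC eqxx; congr (_ + _).
(* A nonempty product contains the factor ['X] from [i = 0], so its constant coefficient vanishes;
   the empty one gives the term [fpsX]. *)
case: n => [|n]; first by rewrite big_nil coef1.
by rewrite big_nat_recl //= addr0 mulrC coefMX.
Qed.
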